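(* Let $a\ge 2$, $c>0$, $d$ be integers with $d<ca$ and $\gcd(d,a)=\gcd(d,c)=1$. For each integer $n\ge 1$ let $S_n=\langle\{ca^{n+j}-d:j\in\mathbb N\}\rangle$. Then for all $n\ge 1$ we have $e(S_n)\ge n$.
   Context: $\mathbb N=\{0,1,2,\ldots\}$. For $A\subseteq\mathbb N$, $\langle A\rangle$ is the submonoid of $(\mathbb N,+)$ generated by $A$. For a nontrivial submonoid $M$ of $\mathbb N$, the minimal generating set of $M$ is the unique generating set contained in every generating set of $M$ (its elements are the nonzero elements of $M$ that are not sums of two nonzero elements of $M$; it is finite), and $e(M)$ is its cardinality. *)

(* Defs.v *)
From HB Require Import structures.
From mathcomp Require Import all_boot all_order all_algebra finmap.
From mathcomp Require Import boolp classical_sets functions cardinality.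

Set Implicit Arguments.
Unset Strict Implicit.
Unset Printing Implicit Defensive.

Import Order.TTheory GRing.Theory Num.Theory.

Local Open Scope classical_set_scope.
Local Open Scope nat_scope.

Definition submonoid (M : set nat) : Prop :=
  M 0 /\ forall x y, M x -> M y -> M (x + y).

Definition generated (A : set nat) : set nat := smallest submonoid A.

(* B generates M and is contained in every generating set of M; such a B is
   unique when it exists. *)
Definition is_minimal_generating_set (M B : set nat) : Prop :=
  generated B = M /\ forall A : set nat, generated A = M -> B `<=` A.

Definition minimal_generating_set (M : set nat) : set nat :=
  xget set0 [set B | is_minimal_generating_set M B].

(* fset_set sends an infinite set to the empty fset, so embdim would be 0 there;
   minimal generating sets of submonoids of nat are always finite. *)
Definition embdim (M : set nat) : nat :=
  #|` fset_set (minimal_generating_set M)|%fset.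

(* If d < c * a, a >= 2 and c > 0, then c * a ^+ (n + j) - d is positive for
   n >= 1, so no generator is lost by describing the set inside nat. *)
Definition semigroupS (a c d : int) (n : nat) : set nat :=
  generated [set x : nat | exists j : nat, (x%:Z = c * a ^+ (n + j) - d)%R].

(* Main.v *)
Require Import Defs.
From mathcomp Require Import all_boot all_order all_algebra finmap.
From mathcomp Require Import boolp classical_sets functions cardinality.
From mathcomp Require Import zify ring.

Set Implicit Arguments.
Unset Strict Implicit.
Unset Printing Implicit Defensive.

Import Order.TTheory GRing.Theory Num.Theory.

(** The generators [s_k = c a^(n+k) - d] with [k < n] are atoms of [S_n].
    Suppose that [s_k] is a sum of [m >= 2] generators, say
    [s_k = c a^n N - m d], where [N >= m] is the sum of the corresponding powers
    of [a].  Then [c a^n] divides [(m - 1) d], hence [m - 1], so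
    [s_k >= m (c a^n - d) >= (c a^n + 1) (c a^n - d)], which exceeds
    [c a^(2n-1) - d] because [d < c a].
    The minimal generating set of a submonoid of [nat] is its set of atoms,
    which is finite since two atoms are never congruent modulo a nonzero
    element of the submonoid unless they are equal. *)

Definition atom (M : set nat) : set nat :=
  [set x | [/\ M x, x != 0 &
    forall y z, M y -> M z -> x = y + z -> y = 0 \/ z = 0]].

Lemma generated_submonoid (A : set nat) : submonoid (generated A).
Proof.
split=> [M [[M0 _] _] //|x y Ax Ay M [Mmon AM]].
by apply: Mmon.2; [apply: Ax | apply: Ay].
Qed.

Lemma sub_generated (A : set nat) : (A `<=` generated A)%classic.
Proof. exact: sub_smallest. Qed.

Lemma generated_sub (A M : set nat) :
  submonoid M -> (A `<=` M -> generated A `<=` M)%classic.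
Proof. by move=> Mmon AM; apply: smallest_sub. Qed.

Lemma submonoid_muln (M : set nat) p k : submonoid M -> M p -> M (k * p).
Proof.
move=> [M0 MD] Mp; elim: k => [|k IHk]; first by rewrite mul0n.
by rewrite mulSn; apply: MD.
Qed.

(** Strong induction: a nonzero non-atom splits into two nonzero, hence smaller, elements of [M]. *)
Lemma generated_atom (M : set nat) : submonoid M -> generated (atom M) = M.
Proof.
move=> Mmon; apply/seteqP; split; first by apply: generated_sub => // x [].
move=> x; have [g0 gD] := generated_submonoid (atom M).
have [k] := ubnP x; elim: k x => // k IHk x lexk Mx.
have [-> //|x_neq0] := eqVneq x 0.
have [/sub_generated //|not_atom] := pselect (atom M x).
have [y [z [My Mz xE y0 z0]]] :
    exists y z, [/\ M y, M z, x = y + z, y <> 0 & z <> 0].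
  apply: contrapT => nyz; apply: not_atom; split=> // y z My Mz xE.
  have [y0|y0] := pselect (y = 0); first by left.
  have [z0|z0] := pselect (z = 0); first by right.
  by case: nyz; exists y, z.
by rewrite xE; apply: gD; apply: IHk => //; lia.
Qed.

(* Removing an atom from a submonoid leaves a submonoid. *)
Lemma atom_sub_generators (A : set nat) :
  (atom (generated A) `<=` A)%classic.
Proof.
move=> x [gx x_neq0 xatom]; apply: contrapT => nAx.
have [g0 gD] := generated_submonoid A.
suff /(_ x gx) [_ /(_ erefl)//] :
  (generated A `<=` [set y | generated A y /\ y <> x])%classic.
apply: generated_sub => [|y Ay]; last first.
  by split; [exact: sub_generated | move=> yx; apply: nAx; rewrite -yx].
split=> [|y z [gy yx] [gz zx]].
  by split=> // x0; rewrite -x0 eqxx in x_neq0.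
split; first exact: gD.
by move=> /esym yzx; case: (xatom y z gy gz yzx) => ?; lia.
Qed.

(** The atoms witness the defining property, so [xget] does not fall back on [set0]; minimality of
    both sets gives the two inclusions. *)
Lemma minimal_generating_set_atom (M : set nat) :
  submonoid M -> minimal_generating_set M = atom M.
Proof.
move=> Mmon; have atomP : is_minimal_generating_set M (atom M).
  by split=> [|A <-]; [exact: generated_atom | exact: atom_sub_generators].
have [gB Bmin] : is_minimal_generating_set M (minimal_generating_set M).
  by apply: (xgetPex set0 (P := [set B | is_minimal_generating_set M B]));
     exists (atom M).
by apply/seteqP; split; [apply: Bmin; apply: atomP.1 | apply: atomP.2].
Qed.

Lemma finite_atom (M : set nat) : submonoid M -> finite_set (atom M).
Proof.
move=> Mmon; have [[p [Mp p_neq0]]|M_triv] := pselect (exists p, M p /\ p <> 0);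
  last first.
  suff -> : atom M = set0 by exact: finite_set0.
  by apply/seteqP; split=> // x [Mx x0 _]; apply: M_triv; exists x; split=> //; lia.
have atom_mod x y : atom M x -> atom M y -> x %% p = y %% p -> x <= y -> x = y.
  move=> [Mx x0 _] [My _ yatom] exy lexy.
  (* Both summands lie in [M] and [x] is nonzero, so the multiple of [p] vanishes. *)
  have yE : y = x + (y %/ p - x %/ p) * p.
    rewrite mulnBl {1}(divn_eq y p) {1}(divn_eq x p) exy.
    have := leq_mul (leq_div2r p lexy) (leqnn p); lia.
  have [] := yatom _ _ Mx (submonoid_muln (y %/ p - x %/ p) Mmon Mp) yE; lia.
have modI : {in atom M &, injective (fun x => x %% p)}.
  move=> x y /set_mem xA /set_mem yA exy.
  have [lexy|/ltnW leyx] := leqP x y; first exact: atom_mod.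
  by apply/esym/atom_mod.
rewrite -(eq_finite_set (inj_card_eq modI)).
apply: (@sub_finite_set _ _ `I_p); last exact: finite_II.
by move=> _ [x _ <-] /=; rewrite ltn_mod; lia.
Qed.

(** Finiteness of the atoms matters here: [fset_set] would send an infinite set to the empty one. *)
Lemma leq_embdim (M : set nat) n (s : 'I_n -> nat) :
  submonoid M -> injective s -> (forall k, atom M (s k)) -> n <= embdim M.
Proof.
move=> Mmon sI satom; rewrite /embdim minimal_generating_set_atom //.
have finA := finite_atom Mmon.
rewrite -[leqLHS]card_ord -(size_image s).
have us : uniq [seq s k | k : 'I_n] by rewrite map_inj_uniq // enum_uniq.
apply: uniq_leq_size us _ => _ /mapP[k _ ->].
by rewrite in_fset_set // mem_set.
Qed.

Lemma generator_gt0 (a c d : int) n j :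
  (2 <= a)%R -> (0 < c)%R -> (d < c * a)%R -> 0 < n ->
  (0 < c * a ^+ (n + j) - d)%R.
Proof.
move=> ha hc hd; case: n => // n _; rewrite addSn exprS.
have : (1 <= a ^+ (n + j))%R by apply: exprn_ege1; lia.
nia.
Qed.

(* [m] counts the generators in a sum and [N] adds up their powers [a ^+ j]. *)
Lemma semigroupS_repr (a c d : int) n x : (2 <= a)%R -> semigroupS a c d n x ->
  exists (m : nat) (N : int),
    [/\ (x%:Z = c * a ^+ n * N - m%:Z * d)%R, (m%:Z <= N)%R &
        m = 0 -> x = 0].
Proof.
move=> ha; move: x; apply: generated_sub.
  split; first by exists 0, 0%R; split=> //; ring.
  move=> x y [m1 [N1 [xE le1 x0]]] [m2 [N2 [yE le2 y0]]].
  exists (m1 + m2), (N1 + N2)%R; split; [|lia..].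
  by rewrite !PoszD xE yE; ring.
move=> x [j xE]; exists 1, (a ^+ j)%R; split=> //.
  by rewrite xE exprD; ring.
by apply: exprn_ege1; lia.
Qed.

Lemma sum_generators_eq_generator (a c d : int) (n k m : nat) (N : int) :
  (2 <= a)%R -> (0 < c)%R -> (d < c * a)%R -> coprimez d a -> coprimez d c ->
  0 < n -> 1 < m -> (m%:Z <= N)%R ->
  (c * a ^+ n * N - m%:Z * d = c * a ^+ (n + k) - d)%R -> n <= k.
Proof.
move=> ha hc hd hda hdc n_gt0 m_gt1 leN sE; rewrite leqNgt; apply/negP=> ltkn.
have q_dvd : ((c * a ^+ n)%R %| (m%:Z - 1)%R)%Z.
  (* By [sE], [(m - 1) d = c a^n (N - a^k)], and [c a^n] is coprime to [d]. *)
  rewrite -(@Gauss_dvdzl _ _ d).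
    apply/dvdzP; exists (N - a ^+ k)%R.
    rewrite exprD in sE; transitivity (m%:Z * d - d)%R; first by ring.
    by transitivity (c * a ^+ n * N - c * (a ^+ n * a ^+ k))%R; [lia | ring].
  by rewrite coprimez_sym coprimezMr hdc coprimezXr.
(* The exponent becomes [n.+1], so that [k <= n] and [a^k] is at most [t = a^n]. *)
case: n n_gt0 ltkn sE q_dvd => // n _ ltkn.
rewrite exprD exprS; set t := (a ^+ n)%R; set q := (c * (a * t))%R => sE q_dvd.
have t_ge1 : (1 <= t)%R by apply: exprn_ege1; lia.
have le_akt : (a ^+ k <= t)%R by apply: ler_weXn2l; lia.
have ca_ge2 : (2 <= c * a)%R by nia.
have q_ge : (c * a <= q)%R by rewrite /q mulrA; nia.
have leqm : (q <= m%:Z - 1)%R.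
  have : `|q|%N <= `|(m%:Z - 1)%R|%N by apply: dvdn_leq => //; lia.
  lia.
(* Since [N >= m], the sum is at least [m (q - d)], and [m >= q + 1]. *)
have s_ge : ((q + 1) * (q - d) <= q * a ^+ k - d)%R.
  have -> : (q * a ^+ k - d = q * N - m%:Z * d)%R.
    by rewrite sE /q; ring.
  apply: (@le_trans _ _ (m%:Z * (q - d)))%R; first by apply: ler_wpM2r; lia.
  rewrite mulrBr lerD2r mulrC; apply: ler_wpM2l; lia.
have s_le : (q * a ^+ k <= q * t)%R by apply: ler_wpM2l; lia.
have gap : (0 < q - d + 1 - t)%R.
  (* Expanded, this reads [q - c a + 1 - t >= 0]; then [d < c a] makes the gap strict. *)
  have : (0 <= (c * a - 1) * (t - 1))%R by apply: mulr_ge0; lia.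
  have -> : ((c * a - 1) * (t - 1) = q - c * a - t + 1)%R by rewrite /q; ring.
  lia.
(* This product is the excess of the lower bound [(q + 1)(q - d)] over the upper bound [q t - d]. *)
have : (0 < q * (q - d + 1 - t))%R by apply: mulr_gt0; lia.
have -> : (q * (q - d + 1 - t) = (q + 1) * (q - d) - (q * t - d))%R by ring.
lia.
Qed.

Theorem theorem3p6 (a c d : int)
    (ha : (2 <= a)%R) (hc : (0 < c)%R) (hd : (d < c * a)%R)
    (hda : gcdz d a = 1%R) (hdc : gcdz d c = 1%R)
    (n : nat) (hn : (1 <= n)%N) :
  (n <= embdim (semigroupS a c d n))%N.
Proof.
pose s k : nat := `|(c * a ^+ (n + k) - d)%R|%N.
have s_gt0 k : (0 < c * a ^+ (n + k) - d)%R by apply: generator_gt0.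
have sE k : ((s k)%:Z = c * a ^+ (n + k) - d)%R by apply/gez0_abs/ltW.
apply: (@leq_embdim _ _ (fun k : 'I_n => s k)).
- exact: generated_submonoid.
- move=> i j /(congr1 Posz); rewrite !sE => /addIr /mulfI.
  move=> /(_ (lt0r_neq0 hc)) /ieexprIn sij; apply/val_inj/(@addnI n)/sij; lia.
move=> k; split.
- by apply: sub_generated; exists k.
- by have := s_gt0 k; rewrite -sE; lia.
move=> x y /(semigroupS_repr ha) [m1 [N1 [xE le1 x0]]].
move=> /(semigroupS_repr ha) [m2 [N2 [yE le2 y0]]] xyE.
(* A nonzero summand uses at least one generator, so two of them give [m1 + m2 >= 2]. *)
have [/x0|m1_gt0] := posnP m1; first by left.
have [/y0|m2_gt0] := posnP m2; first by right.
suff : n <= k by rewrite leqNgt ltn_ord.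
apply: (@sum_generators_eq_generator a c d n k (m1 + m2) (N1 + N2)) => //.
- by rewrite /coprimez hda.
- by rewrite /coprimez hdc.
- lia.
- lia.
by rewrite -sE xyE !PoszD xE yE; ring.
Qed.
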